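(* The following statements are equivalent (in ZFC): (1) Every Corson compactum which supports a strictly positive measure is metrizable. (2) $MA_{\omega_1}$ for measure algebras.
   Context: A compact Hausdorff space $X$ is a Corson compactum if for some cardinal $\kappa$ it is homeomorphic to a subspace of $\Sigma(\mathbb{R}^\kappa)=\{x \in \mathbb{R}^\kappa : |\{\alpha<\kappa: x(\alpha)\neq 0\}| \leq \aleph_0\}$. Measures are Radon probability measures; a measure $\mu$ on $X$ is strictly positive if $\mu(U)>0$ for every non-empty open $U \subseteq X$. A measure algebra is the poset of non-zero elements of the Boolean algebra of measurable sets modulo null sets of a probability measure space, ordered by inclusion. $MA_{\omega_1}$ for measure algebras is the statement: for every measure algebra $\mathbb{P}$ and every family of $\aleph_1$ dense subsets of $\mathbb{P}$ there is a filter on $\mathbb{P}$ meeting all of them (equivalently, every measure algebra has precaliber $\omega_1$: every uncountable subset contains an uncountable centered subset). *)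

(* Defs.v *)
From HB Require Import structures.
From mathcomp Require Import all_boot all_order all_algebra.
From mathcomp Require Import all_classical all_reals all_analysis.
Set Implicit Arguments. Unset Strict Implicit. Unset Printing Implicit Defensive.
Import Order.TTheory GRing.Theory Num.Theory.
Local Open Scope classical_set_scope.
Local Open Scope ring_scope.

(* A type I has cardinality exactly aleph_1 iff it is uncountable and carries a
   strict well-order all of whose proper initial segments are countable
   (i.e. its order type is omega_1). *)
Definition card_aleph1 (I : Type) : Prop :=
  ~ countable [set: I] /\
  exists lt : I -> I -> Prop,
    well_founded lt /\
    (forall x y z, lt x y -> lt y z -> lt x z) /\
    (forall x y, lt x y \/ x = y \/ lt y x) /\
    (forall x, countable [set y | lt y x]).

(* The measure algebra of (T, measurable, mu): non-zero elements of the Boolean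
   algebra of measurable sets modulo null sets, ordered by inclusion.  We work
   with representatives: an element is a measurable set of positive measure, and
   A <= B in the measure algebra iff mu (A \ B) = 0. *)
Section MeasureAlgebra.
Context {R : realType} {d : measure_display} {T : measurableType d}.
Variable mu : probability T R.

Definition ma_elt (A : set T) : Prop := measurable A /\ (0 < mu A)%E.
Definition ma_le (A B : set T) : Prop := mu (A `\` B) = 0%E.

Definition ma_dense (D : set (set T)) : Prop :=
  D `<=` ma_elt /\
  forall p, ma_elt p -> exists q, D q /\ ma_le q p.

Definition ma_filter (G : set (set T)) : Prop :=
  G `<=` ma_elt /\ G !=set0 /\
  (forall p q, G p -> ma_elt q -> ma_le p q -> G q) /\
  (forall p q, G p -> G q -> exists r, G r /\ ma_le r p /\ ma_le r q).
End MeasureAlgebra.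

Definition MA_omega1_measure_algebras (R : realType) : Prop :=
  forall (d : measure_display) (T : measurableType d) (mu : probability T R)
         (I : Type) (D : I -> set (set T)),
    card_aleph1 I ->
    (forall i, ma_dense mu (D i)) ->
    exists G : set (set T), ma_filter mu G /\
      forall i, exists A, G A /\ D i A.

Definition Sigma_prod (R : realType) (K : Type) : set (prod_topology (fun _ : K => R^o)) :=
  [set x | countable [set a | x a != 0]].

Definition embedding {X Y : topologicalType} (f : X -> Y) : Prop :=
  continuous f /\ injective f /\
  (forall U : set X, open U ->
     exists V : set Y, open V /\ f @` U = f @` setT `&` V).

Definition corson_compactum (R : realType) (X : topologicalType) : Prop :=
  compact [set: X] /\ hausdorff_space X /\
  exists (K : Type) (f : X -> prod_topology (fun _ : K => R^o)),
    embedding f /\ f @` setT `<=` @Sigma_prod R K.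

Definition borel_type (X : ptopologicalType) := g_sigma_algebraType (@open X).

Definition radon {R : realType} {X : ptopologicalType}
    (mu : probability (borel_type X) R) : Prop :=
  forall B : set X, measurable (B : set (borel_type X)) ->
    mu B = ereal_sup [set mu K | K in [set K : set X | compact K /\ K `<=` B]].

Definition strictly_positive {R : realType} {X : ptopologicalType}
    (mu : probability (borel_type X) R) : Prop :=
  forall U : set X, open U -> U !=set0 -> (0 < mu U)%E.

Definition metrizable (R : realType) (X : topologicalType) : Prop :=
  exists dist : X -> X -> R,
    (forall x y, 0 <= dist x y) /\
    (forall x y, dist x y = 0 <-> x = y) /\
    (forall x y, dist x y = dist y x) /\
    (forall x y z, dist x z <= dist x y + dist y z) /\
    (forall U : set X, open U <->
       (forall x, U x -> exists2 e : R, 0 < e & [set y | dist x y < e] `<=` U)).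

Definition corson_positive_measure_metrizable (R : realType) : Prop :=
  forall X : ptopologicalType,
    corson_compactum R X ->
    (exists mu : probability (borel_type X) R, radon mu /\ strictly_positive mu) ->
    metrizable R X.

(* Main.v *)
Require Import Defs.
From HB Require Import structures.
From mathcomp Require Import all_boot all_order all_algebra.
From mathcomp Require Import lra.
From mathcomp Require Import all_classical all_reals all_analysis.
Set Implicit Arguments. Unset Strict Implicit. Unset Printing Implicit Defensive.
Import Order.TTheory GRing.Theory Num.Theory.
Local Open Scope classical_set_scope.
Local Open Scope ring_scope.

(* MA for measure algebras implies that they have precaliber omega_1: the
   essential suprema of the tails of a family of aleph_1 positive elements
   stabilize, and below the stable value it is dense to lie under a late member
   of the family.  A Corson compactum with uncountably many active coordinates
   and a strictly positive measure yields closed sets {|x_a| >= 1/n_a} of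
   positive measure; a point common to uncountably many of them has an
   uncountable support.  So only countably many coordinates are active, and they
   give a metric.

   Conversely, from dense sets D_i (i < omega_1) of a measure algebra that no
   filter meets, take a countable subfamily of D_i with conull union and let A_i
   be a set of positive measure contained, for every j < i, in a finite union of
   members of the j-th subfamily.  An ultrafilter containing uncountably many A_i
   would meet every D_i, so centered families of A_i are countable.  Hence the
   Stone space of the algebra generated by the A_i, as a subspace of 2^omega_1,
   is a Corson compactum; it carries a strictly positive Radon measure, and it is
   not separable because every coordinate is active.  The measure of a set E of
   points is the infimum of mu C over the measurable C which belong to the filter
   of every point of E. *)

(** * Null sets and ultrafilters *)

Section ProbabilityNullSets.
Context {R : realType} {d : measure_display} {T : measurableType d}.
Variable mu : probability T R.
Local Open Scope ereal_scope.

Lemma null_setU (A B : set T) : measurable A -> measurable B ->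
  mu A = 0 -> mu B = 0 -> mu (A `|` B) = 0.
Proof. by move=> mA mB A0 B0; rewrite measureU0. Qed.

Lemma measure_gt0 (A : set T) : measurable A -> mu A != 0 -> 0 < mu A.
Proof. by move=> mA; rewrite lt0e measure_ge0 andbT. Qed.

Lemma le_measure_null (A B : set T) : measurable A -> measurable B ->
  mu (A `\` B) = 0 -> mu A <= mu B.
Proof.
move=> mA mB AB0; rewrite (measureDI mu mA mB) [X in X + _]AB0 add0e.
apply: le_measure; rewrite ?inE; [exact: measurableI|exact: mB|exact: subIsetr].
Qed.

Lemma null_bigcup (A : nat -> set T) : (forall n, measurable (A n)) ->
  (forall n, mu (A n) = 0) -> mu (\bigcup_n A n) = 0.
Proof.
move=> mA A0; have mU : measurable (\bigcup_n A n) by exact: bigcup_measurable.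
apply/(negligibleP mu mU); apply: negligible_bigcup => n.
by apply/negligibleP; [exact: mA|exact: A0].
Qed.

Lemma null_setD_trans (A B C : set T) :
  measurable A -> measurable B -> measurable C ->
  mu (A `\` B) = 0 -> mu (B `\` C) = 0 -> mu (A `\` C) = 0.
Proof.
move=> mA mB mC AB BC.
have mAB := measurableD mA mB; have mBC := measurableD mB mC.
apply: (subset_measure0 _ (measurableU _ _ mAB mBC)).
- exact: measurableD.
- by move=> t [At Ct]; case: (pselect (B t)) => Bt; [right|left].
- exact: null_setU.
Qed.

(* An essential supremum of an arbitrary family is reached along a sequence:
   maximize the measure of countable unions. *)
Lemma essential_union (P : set (set T)) : P `<=` measurable -> P !=set0 ->
  exists A : nat -> set T, (forall n, P (A n)) /\
    forall B, P B -> mu (B `\` \bigcup_n A n) = 0.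
Proof.
move=> Pm [P0 PP0].
pose S := [set mu (\bigcup_n A n) | A in [set A : nat -> set T | forall n, P (A n)]].
have mU (A : nat -> set T) : (forall n, P (A n)) -> measurable (\bigcup_n A n).
  by move=> PA; apply: bigcup_measurable => n _; exact: Pm.
have Sub (A : nat -> set T) : (forall n, P (A n)) ->
    mu (\bigcup_n A n) <= ereal_sup S.
  by move=> PA; apply: ereal_sup_ubound; exists A.
have Sfin : ereal_sup S \is a fin_num.
  rewrite ge0_fin_numE; last exact: le_trans (Sub (fun=> P0) (fun=> PP0)).
  apply: (@le_lt_trans _ _ 1); last exact: ltry.
  apply: ge_ereal_sup => _ [A PA <-]; apply: probability_le1; exact: mU.
have /choice[A_ HA_] (n : nat) : exists A : nat -> set T, (forall m, P (A m)) /\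
    ereal_sup S - (n.+1%:R^-1)%:E < mu (\bigcup_m A m).
  have n0 : (0 < n.+1%:R^-1 :> R)%R by rewrite invr_gt0.
  by have [_ [A PA <-] lt] := ub_ereal_sup_adherent n0 Sfin; exists A.
(* [B] runs through all the sets [A_ i j] in one sequence by coding pairs; a number that codes no
   pair gets the default [A_ 0 0]. Its union contains each of the nearly optimal unions, so it
   attains the supremum. *)
pose B (m : nat) : set T :=
  if unpickle m is Some (i, j) then A_ i j else A_ 0%N 0%N.
have PB m : P (B m).
  rewrite /B; case: (unpickle m) => [[i j]|]; first by case: (HA_ i).
  by case: (HA_ 0%N).
have AB n : \bigcup_m A_ n m `<=` \bigcup_m B m.
  by move=> t [m _ At]; exists (pickle (n, m)) => //; rewrite /B pickleK.
have SB : ereal_sup S <= mu (\bigcup_m B m).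
  apply/lee_addgt0Pr => e e0.
  have [n ne] : exists n : nat, (n.+1%:R^-1 < e)%R.
    by have [n] := ltr_add_invr e0; rewrite add0r; exists n.
  rewrite -leeBlDr//.
  apply: le_trans (_ : ereal_sup S - (n.+1%:R^-1)%:E <= _).
    by rewrite leeB// lee_fin ltW.
  case: (HA_ n) => PA /ltW /le_trans; apply.
  apply: le_measure; rewrite ?inE; [exact: mU|exact: mU|exact: AB].
exists B; split=> // C PC.
(* Putting [C] in front of [B] gives another competitor for the supremum, so its union cannot be
   larger in measure and [C] adds only a null set. *)
pose D n := if n is n'.+1 then B n' else C.
have PD n : P (D n) by case: n => [|n] /=.
have DE : \bigcup_n D n = (C `\` \bigcup_n B n) `|` \bigcup_n B n.
  apply/seteqP; split=> [t [[|n] _ /= Dt]|t [[Ct _]|[n _ Bt]]].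
  - by case: (pselect ((\bigcup_n B n) t)) => Bt; [right|left].
  - by right; exists n.
  - by exists 0%N.
  - by exists n.+1.
have mB := mU _ PB.
have mCB : measurable (C `\` \bigcup_n B n) by apply: measurableD => //; exact: Pm.
have := le_trans (Sub _ PD) SB.
rewrite DE measureU//; last by rewrite setDE -setIA setICl setI0.
rewrite -leeBrDr ?subee ?fin_num_measure// => le0.
apply/eqP; rewrite eq_le measure_ge0 andbT; exact: le0.
Qed.

(** Finite intersections minus null sets generate a proper filter, since a set of positive measure
    does not lie in a null set. The last clause ensures that every measurable member of [z] has
    positive measure. *)
Lemma centered_ultrafilter (I : Type) (J : set I) (A : I -> set T) :
  (forall i, J i -> measurable (A i)) ->
  (forall F, finite_set F -> F `<=` J -> 0 < mu (\bigcap_(i in F) A i)) ->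
  exists z : set_system T, UltraFilter z /\ (forall i, J i -> z (A i)) /\
    (forall N, measurable N -> mu N = 0 -> z (~` N)).
Proof.
move=> mA cent.
have mF F : finite_set F -> F `<=` J -> measurable (\bigcap_(i in F) A i).
  by move=> Ff FJ; apply: fin_bigcap_measurable => // i /FJ/mA.
pose Phi : set_system T := [set B | exists F N, [/\ finite_set F, F `<=` J,
  measurable N, mu N = 0 & (\bigcap_(i in F) A i) `\` N `<=` B]].
have PF : ProperFilter Phi.
  apply: Build_ProperFilter_ex.
    move=> B [F [N [Ff FJ mN N0 sB]]].
    case: (pselect ((\bigcap_(i in F) A i) `\` N `<=` set0)) => [s0|].
      have := cent F Ff FJ; rewrite lt0e => /andP[/eqP[]].
      apply: (subset_measure0 (mF _ Ff FJ) mN _ N0) => t Ft.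
      by apply: contrapT => Nt; exact: (s0 t).
    by move=> /existsNP[t /not_implyP[tFN _]]; exists t; exact: sB.
  split.
  - by exists set0, set0; split=> //; exact: finite_set0.
  - move=> B C [F [N [Ff FJ mN N0 sB]]] [F' [N' [Ff' FJ' mN' N0' sC]]].
    exists (F `|` F'), (N `|` N'); split.
    + by rewrite finite_setU.
    + by move=> i [/FJ|/FJ'].
    + exact: measurableU.
    + exact: null_setU.
    + move=> t [tF tN]; split.
        by apply: sB; split=> [i Fi|Nt]; [apply: tF; left|apply: tN; left].
      by apply: sC; split=> [i Fi|Nt]; [apply: tF; right|apply: tN; right].
  - move=> B C BC [F [N [Ff FJ mN N0 sB]]]; exists F, N; split=> //.
    exact: subset_trans BC.
have [z [Uz sz]] := ultraFilterLemma PF.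
exists z; split=> //; split.
  move=> i Ji; apply: sz; exists [set i], set0; split=> //.
  - by move=> j ->.
  - by move=> t [/(_ i erefl)].
move=> N mN N0; apply: sz; by exists set0, N; split=> // t [].
Qed.

Lemma ultrafilter_of_positive (A : set T) : measurable A -> 0 < mu A ->
  exists z : set_system T, UltraFilter z /\ z A /\
    (forall N, measurable N -> mu N = 0 -> z (~` N)).
Proof.
move=> mA A0.
have mA' : forall i : unit, setT i -> measurable A by [].
have [F _ _|z [Uz [zA zN]]] := centered_ultrafilter mA'.
  apply: (lt_le_trans A0); apply: le_measure; rewrite ?inE//; last by move=> t At i.
  by apply: fin_bigcap_measurable => //; exact: finite_finset.
by exists z; split=> //; split=> //; exact: (zA tt).
Qed.

End ProbabilityNullSets.

(** * Sets of cardinality aleph_1 *)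

Lemma countableU (T : Type) (A B : set T) :
  countable A -> countable B -> countable (A `|` B).
Proof.
move=> cA cB; rewrite -bigcup2E; apply: bigcup_countable => // -[|[|n]] _ //=.
Qed.

Lemma countableS (T : Type) (A B : set T) :
  A `<=` B -> countable B -> countable A.
Proof. by move=> AB; apply: sub_countable; exact: subset_card_le. Qed.

Lemma finite_set_ind (T : Type) (P : set T -> Prop) : P set0 ->
  (forall x F, finite_set F -> P F -> P (x |` F)) -> forall F, finite_set F -> P F.
Proof.
move=> P0 PU F /(@finite_seqP {classic T})[s ->].
elim: s => [|x s IH]; first by rewrite set_nil.
rewrite (_ : [set` x :: s] = x |` [set` s]); first exact: PU (finite_seq s) IH.
apply/seteqP; split=> y /=; rewrite inE; first by move=> /orP[/eqP|]; [left|right].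
by move=> [->|->]; rewrite ?eqxx ?orbT.
Qed.

(** Existence and uniqueness of least elements give everything: two-point sets yield totality and
    antisymmetry, three-point sets yield transitivity. *)
Lemma wellorder_exists (K : Type) : exists r : K -> K -> Prop,
  [/\ forall x y, r x y \/ r y x, forall x y, r x y -> r y x -> x = y,
      forall x y z, r x y -> r y z -> r x z &
      forall A : set K, A !=set0 -> exists2 m, A m & forall x, A x -> r m x].
Proof.
have [R0 woR] := wochoice.well_ordering_principle {classic K}.
have minR (A : set K) : A !=set0 -> exists! m, A m /\ forall x, A x -> R0 m x.
  move=> [a Aa]; have [|m [[mA minm] um]] := woR (fun x : {classic K} => `[< A x >]).
    by exists a; apply/asboolP.
  exists m; split=> [|m' [Am' minm']].
    split=> [|x Ax]; first by apply/asboolP; exact: mA.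
    by apply: minm; apply/asboolP.
  apply: um; split; first by apply/asboolP.
  by move=> x /asboolP Ax; exact: minm'.
have tot x y : R0 x y \/ R0 y x.
  have [|m [[[->|->] mm] _]] := minR [set x; y]; first by exists x; left.
  - by left; apply: mm; right.
  - by right; apply: mm; left.
have refl x : R0 x x by case: (tot x x).
have anti x y : R0 x y -> R0 y x -> x = y.
  move=> xy yx; have [|m [_ um]] := minR [set x; y]; first by exists x; left.
  rewrite -(um x) ?(um y) //.
  - by split=> [|z [->|->]] //; right.
  - by split=> [|z [->|->]] //; left.
exists (fun x y => R0 x y); split=> //.
- move=> x y z xy yz.
  have [|m [[[[->|->]|->] mm] _]] := minR [set x; y; z]; first by exists x; left; left.
  + by apply: mm; right.
  + by rewrite (anti x y xy) //; apply: mm; left; left.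
  + have <- : y = z by apply: anti => //; apply: mm; left; right.
    exact: xy.
- by move=> A /minR[m [[Am mm] _]]; exists m.
Qed.

(** Keep the points of [S] with a countable initial segment. If there were only countably many, the
    least point of [S] left out would have its segment among them and itself, hence countable. *)
Lemma uncountable_has_aleph1 (K : Type) (S : set K) : ~ countable S ->
  exists2 I : set K, I `<=` S & card_aleph1 {x : K | I x}.
Proof.
move=> ncS; have [r [tot anti tr minr]] := wellorder_exists K.
pose seg x := [set y | S y /\ r y x].
pose I := [set x | S x /\ countable (seg x)].
have ncI : ~ countable I.
  move=> cI; case: (pselect (S `<=` I)) => [SI|]; first exact/ncS/countableS/cI.
  move=> /existsNP[a /not_implyP[Sa nIa]].
  have [|m [Sm nIm] mm] := minr (S `\` I); first by exists a.
  apply: nIm; split=> //; apply: (@countableS _ _ (I `|` [set m])).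
    move=> y [Sy ym]; case: (pselect (I y)) => Iy; [by left|right].
    by apply: anti => //; exact: mm.
  exact/countableU/countable1.
exists I; first by move=> x [].
split.
  move=> c; apply: ncI.
  have -> : I = [set sval x | x in [set: {x : K | I x}]].
    apply/seteqP; split=> [x Ix|_ [x _ <-]]; first by exists (exist _ x Ix).
    exact: svalP.
  exact: sub_countable (card_image_le _ _) c.
exists (fun a b => r (sval a) (sval b) /\ a <> b).
have svinj (a b : {x | I x}) : sval a = sval b -> a = b.
  by case: a b => a Ia [b Ib] /= ab; subst b; rewrite (Prop_irrelevance Ia Ib).
split.
  move=> a; apply: contrapT => na.
  have [|_ [m nm <-] mm] := minr [set sval x | x in [set x | ~ Acc
    (fun a b : {x | I x} => r (sval a) (sval b) /\ a <> b) x]].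
    by exists (sval a), a.
  apply: nm; constructor => y [ym yNm]; apply: contrapT => ny.
  by apply: yNm; apply: svinj; apply: anti => //; apply: mm; exists y.
split.
  move=> x y z [xy xNy] [yz yNz]; split; first exact: tr yz.
  by move=> xz; subst z; apply: xNy; apply: svinj; apply: anti.
split.
  move=> x y; case: (pselect (x = y)) => [|xNy]; first by right; left.
  by case: (tot (sval x) (sval y)) => h; [left|right; right]; split=> // /esym.
move=> x; have [Sx cx] := svalP x.
have /countable_injP[f finj] := cx.
apply/countable_injP; exists (f \o sval) => a b.
rewrite !inE => -[ax _] [bx _] /= fab; apply: svinj; apply: finj => //;
  by rewrite inE; split=> //; case: (svalP a); case: (svalP b).
Qed.

Section Aleph1.
Context {I : Type} (lt : I -> I -> Prop).
Hypotheses (ncI : ~ countable [set: I]) (wf : well_founded lt).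
Hypothesis tr : forall x y z, lt x y -> lt y z -> lt x z.
Hypothesis tot : forall x y, lt x y \/ x = y \/ lt y x.
Hypothesis seg : forall x, countable [set y | lt y x].

Lemma aleph1_irr x : ~ lt x x.
Proof. by elim: (wf x) => y _ IH yy; exact: (IH y yy yy). Qed.

(** By totality [~ lt x y] says that [x] is [y] or later; tails of the order are written in this
    form. *)
Lemma aleph1_geq_trans x y z : ~ lt x y -> ~ lt y z -> ~ lt x z.
Proof.
move=> xy yz xz; case: (tot x y) => [//|[xy'|yx]]; first by subst y.
exact: yz (tr yx xz).
Qed.

(** Countably many countable initial segments cannot exhaust [I]. *)
Lemma aleph1_bound (b : nat -> I) : exists x, forall n, ~ lt x (b n).
Proof.
apply: contrapT => nb; apply: ncI.
apply: (@countableS _ _ (\bigcup_n [set x | lt x (b n)])).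
  move=> x _; apply: contrapT => nx; apply: nb; exists x => n xn.
  by apply: nx; exists n.
exact: bigcup_countable.
Qed.

(** A bounded set lies in a countable segment; a countable cofinal set would write [I] as a
    countable union of countable segments. *)
Lemma aleph1_cofinal (J : set I) : ~ countable J <->
  forall x, exists2 a, J a & ~ lt a x.
Proof.
split=> [ncJ x|cof cJ].
  apply: contrapT => nx; apply/ncJ/countableS/(seg x) => a Ja.
  by apply: contrapT => ax; apply: nx; exists a.
apply: ncI; apply: (@countableS _ _ (\bigcup_(a in J) ([set x | lt x a] `|` [set a]))).
  move=> x _; have [a Ja ax] := cof x; exists a => //.
  by case: (tot a x) => [|[->|]] // ; [right|left].
apply: bigcup_countable => // a _; exact/countableU/countable1.
Qed.

End Aleph1.

(** * Precaliber omega_1 *)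

Section ConditionalProbability.
Context {R : realType} {d : measure_display} {T : measurableType d}.
Variable mu : probability T R.
Local Open Scope ereal_scope.

(** Only the null sets of the conditional measure are recorded, because they determine which sets
    are positive and how they are ordered below [S]. *)
Lemma conditional_probability (S : set T) : measurable S -> 0 < mu S ->
  exists nu : probability T R,
    forall X, measurable X -> (nu X = 0 <-> mu (X `&` S) = 0).
Proof.
move=> mS S0; pose nu := mnormalize (mrestr mu mS) mu.
exists nu => X mX; have muT : mrestr mu mS setT = mu S by rewrite /mrestr setTI.
have nuE : nu X = if (mu S == 0) || (mu S == +oo) then mu X
    else mu (X `&` S) * ((fine (mu S))^-1)%:E.
  by rewrite -muT /nu /mnormalize; case: ifP.
suff : nu X = 0 <-> mu (X `&` S) = 0 by [].
rewrite {}nuE.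
have Sfin : mu S \is a fin_num by rewrite fin_num_measure.
have /negbTE -> : ~~ ((mu S == 0) || (mu S == +oo)).
  by rewrite negb_or gt_eqF//=; move: Sfin; case: (mu S).
split=> [/eqP|->]; last by rewrite mul0e.
rewrite mule_eq0 => /orP[/eqP//|]; rewrite eqe invr_eq0 gt_eqF//.
by rewrite fine_gt0// S0 ltey_eq Sfin.
Qed.

End ConditionalProbability.

Lemma MA_precaliber (R : realType) : MA_omega1_measure_algebras R ->
  forall (d : measure_display) (T : measurableType d) (mu : probability T R)
    (I : Type) (A : I -> set T), card_aleph1 I ->
    (forall i, ma_elt mu (A i)) ->
  exists J : set I, ~ countable J /\ forall F, finite_set F -> F `<=` J ->
    (0 < mu (\bigcap_(i in F) A i))%E.
Proof.
move=> MA d T mu I A aI eltA.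
have [ncI [lt [wf [tr [tot seg]]]]] := aI.
have irr := aleph1_irr wf; have getr := @aleph1_geq_trans _ _ tr tot.
have mA i : measurable (A i) by case: (eltA i).
(* [S b] is a sequence taken from the tail that starts at [b]; its union [U b] is the essential
   supremum of that tail. *)
have /choice[S HS] (b : I) : exists B : nat -> set T,
    (forall n, exists2 a, ~ lt a b & B n = A a) /\
    forall a, ~ lt a b -> mu (A a `\` \bigcup_n B n) = 0%E.
  have [_ [a _ <-]||B [HB nB]] :=
      @essential_union _ _ _ mu [set A a | a in [set a | ~ lt a b]].
  - exact: mA.
  - by exists (A b), b => //; exact: irr.
  - exists B; split=> [n|a ab]; last by apply: nB; exists a.
    by have [a ab <-] := HB n; exists a.
pose U b := \bigcup_n S b n.
have mS b n : measurable (S b n) by have [/(_ n)[a _ ->]] := HS b.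
have mU b : measurable (U b) by exact: bigcup_measurable.
have Umono b c : ~ lt c b -> mu (U c `\` U b) = 0%E.
  move=> cb; rewrite /U setDE setI_bigcupl; apply: null_bigcup => n.
    by apply: measurableI => //; exact: measurableC (mU b).
  have [/(_ n)[a ac ->] _] := HS c; have [_] := HS b.
  by rewrite -setDE; apply; exact: getr cb.
(* The essential suprema [U b] of the tails decrease with [b], hence are
   eventually constant in the measure algebra. *)
have [b0 Hb0] : exists b0, forall b, mu (U b0 `\` U b) = 0%E.
  have [i0] : exists i : I, True.
    apply: contrapT => nI; apply: ncI; rewrite (_ : [set: I] = set0).
      exact: countable0.
    by apply/seteqP; split=> // x _; apply: nI; exists x.
  (* Countably many complements of sets [U b] exhaust all of them up to null sets; [b0] is an index
     past those countably many. *)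
  move=> _; have [_ [b _ <-]||V [HV nV]] :=
      @essential_union _ _ _ mu (range (fun b => ~` U b)).
  - exact: measurableC.
  - by exists (~` U i0), i0.
  have /choice[b Hb] n : exists b, ~` U b = V n by have [b _ <-] := HV n; exists b.
  have [b0 bb0] := aleph1_bound ncI seg b.
  have mV n : measurable (V n) by rewrite -Hb; exact: measurableC.
  exists b0 => c.
  have mVc : measurable (~` U c `\` \bigcup_n V n).
    by apply: measurableD; [exact: measurableC|exact: bigcup_measurable].
  have mW n : measurable (U b0 `\` U (b n)) by exact: measurableD.
  apply: (subset_measure0 _ (measurableU _ _ mVc (bigcupT_measurable _ mW))).
  - exact: measurableD.
  - move=> t [b0t ct]; case: (pselect ((\bigcup_n V n) t)) => Vt; last by left.
    by right; case: Vt => n _; rewrite -Hb => nt; exists n.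
  - apply: null_setU => //; first exact: bigcupT_measurable.
      by apply: nV; exists c.
    by apply: null_bigcup => // n; apply: Umono; exact: bb0.
have U0 : (0 < mu (U b0))%E.
  have [_ A0] := eltA b0; apply: (lt_le_trans A0).
  by apply: le_measure_null => //; have [_] := HS b0; apply; exact: irr.
(* Conditioning on [U b0] makes each [U b] conull. Every positive [p] then meets a member of each
   tail in a positive set, which is the density of the sets [D b] below. *)
have [nu nuE] := conditional_probability (mU b0) U0.
have nu_gt0 X : measurable X -> (0 < nu X)%E <-> (0 < mu (X `&` U b0))%E.
  move=> mX; have mXU : measurable (X `&` U b0) by exact: measurableI.
  split=> h; apply: measure_gt0 => //; apply/eqP => h'; move: h.
    by rewrite (nuE _ mX).2// ltxx.
  by rewrite (nuE _ mX).1// ltxx.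
pose D b := [set q | ma_elt nu q /\ exists2 a, ~ lt a b & q `<=` A a].
have [|G [[Gelt [[q0 Gq0] [Gup Gdir]]] GD]] := MA d T nu I D aI.
  move=> b; split=> [q []//|p [mp /(nu_gt0 _ mp) p0]].
  have [n nn] : exists n, mu (p `&` U b0 `&` S b n) != 0%E.
    apply: contrapT => nn.
    have : mu (\bigcup_n (p `&` U b0 `&` S b n) `|` (U b0 `\` U b)) = 0%E.
      apply: null_setU => //.
      - apply: bigcupT_measurable => n; apply: measurableI => //.
        exact: measurableI.
      - exact: measurableD.
      - apply: null_bigcup => n.
          by apply: measurableI => //; exact: measurableI.
        by apply: contrapT => /eqP h; apply: nn; exists n.
    move=> h; move: p0; rewrite (_ : mu _ = 0%E) ?ltxx//.
    apply: subset_measure0 h.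
    - exact: measurableI.
    - apply: measurableU; last exact: measurableD.
      apply: bigcupT_measurable => n; apply: measurableI => //.
      exact: measurableI.
    - move=> t [pt Ut]; case: (pselect (U b t)) => [[n _ St]|Ubt]; last by right.
      by left; exists n.
  have [/(_ n)[a ab E] _] := HS b; rewrite E in nn.
  exists (p `&` A a); split; last first.
    rewrite /ma_le (_ : _ `\` _ = set0) ?measure0//.
    by apply/seteqP; split=> t // [[]].
  have mpA : measurable (p `&` A a) by exact: measurableI.
  split; last by exists a => // t [].
  split=> //; apply/(nu_gt0 _ mpA)/measure_gt0; first exact: measurableI.
  by rewrite setIAC.
(* Each [D b] puts some [A a] with [a] at or past [b] into the filter, so these indices are cofinal;
   being centered follows from directedness. *)
exists [set a | G (A a)]; split.
  apply/(aleph1_cofinal ncI tot seg) => b.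
  have [q [Gq [[mq qpos] [a ab qa]]]] := GD b; exists a => //.
  have ql : ma_le nu q (A a).
    rewrite /ma_le (_ : q `\` A a = set0) ?measure0//.
    by apply/seteqP; split=> t // [/qa].
  apply: (Gup q) => //; split=> //.
  by apply: (lt_le_trans qpos); exact: le_measure_null.
move=> F finF FG.
have mF : measurable (\bigcap_(i in F) A i) by apply: fin_bigcap_measurable => //.
suff [r [Gr rF]] : exists r, G r /\ nu (r `\` \bigcap_(i in F) A i) = 0%E.
  have [mr r0] := Gelt r Gr.
  have /(nu_gt0 _ mF)/lt_le_trans : (0 < nu (\bigcap_(i in F) A i))%E.
    by apply: (lt_le_trans r0); exact: le_measure_null.
  by apply; apply: le_measure; rewrite ?inE//; exact: measurableI.
elim/finite_set_ind : F / finF FG {mF} => [_|x F finF IH FG].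
  by exists q0; rewrite bigcap_set0 setDT measure0.
have [|r [Gr rF]] := IH; first by move=> y Fy; apply: FG; right.
have GAx : G (A x) by apply: FG; left.
have [q [Gq [qr qA]]] := Gdir _ _ Gr GAx.
have [mq _] := Gelt q Gq; have [mr _] := Gelt r Gr.
have mF : measurable (\bigcap_(i in F) A i) by exact: fin_bigcap_measurable.
exists q; split=> //; rewrite bigcap_setU1 setDIr.
by apply: null_setU; [exact: measurableD|exact: measurableD|exact: qA|
  exact: null_setD_trans qr rF].
Qed.

(** * Metrizability of Corson compacta *)

Section SeparatingSequenceMetric.
Context {R : realType} {X : topologicalType} (h : nat -> X -> R^o).
Hypothesis cX : compact [set: X].
Hypothesis ch : forall n, continuous (h n).
Hypothesis sep : forall x y, (forall n, h n x = h n y) -> x = y.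

(** Truncation at [n.+1%:R^-1] leaves only finitely many terms to control for a given radius, so
    balls of the supremum [dist] are neighbourhoods. *)
Let term (x y : X) (n : nat) : R := Num.min n.+1%:R^-1 `|h n x - h n y|.
Let dist (x y : X) : R := sup (range (term x y)).

Let term_ge0 x y n : 0 <= term x y n.
Proof. by rewrite le_min invr_ge0 ler0n normr_ge0. Qed.

Let term_le x y n : term x y n <= dist x y.
Proof.
apply: ub_le_sup; last by exists n.
exists 1 => _ [m _ <-]; rewrite ge_min invf_le1 ?ltr0n// ler1n ltn0Sn.
by [].
Qed.

Let dist_le x y (e : R) : (forall n, term x y n <= e) -> dist x y <= e.
Proof. by move=> te; apply: ge_sup; [exists (term x y 0%N), 0%N|move=> _ [n _ <-]]. Qed.

Let dist_nbhs x (e : R) : 0 < e -> nbhs x [set y | dist x y < e].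
Proof.
move=> e0; have e20 : 0 < e / 2 by rewrite divr_gt0.
have [N] := ltr_add_invr e20; rewrite add0r => Ne.
suff : nbhs x [set y | forall i : 'I_N, `|h i x - h i y| < e / 2].
  apply: filterS => y xy; apply: (@le_lt_trans _ _ (e / 2)).
    apply: dist_le => n; rewrite ge_min; case: (ltnP n N) => nN.
      by rewrite (ltW (xy (Ordinal nN))) orbT.
    apply/orP; left; apply: (le_trans _ (ltW Ne)).
    by rewrite lef_pV2 ?posrE ?ltr0n// ler_nat ltnS.
  by rewrite ltr_pdivrMr// ltr_pMr// ltr1n.
apply: filter_forall => i.
by have /cvgrPdist_lt : h i y @[y --> x] --> h i x := @ch i x; apply.
Qed.

Lemma metrizable_of_separating_sequence : metrizable R X.
Proof.
exists dist; split=> [x y|]; first exact: le_trans (term_ge0 x y 0) (term_le x y 0).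
split=> [x y|].
  split=> [xy0|->]; last first.
    apply/eqP; rewrite eq_le (le_trans (term_ge0 y y 0) (term_le y y 0)) andbT.
    by apply: dist_le => n; rewrite ge_min subrr normr0 lexx orbT.
  apply: sep => n; apply/eqP; rewrite -subr_eq0 -normr_le0.
  have := term_le x y n; rewrite xy0 ge_min => /orP[|//].
  by rewrite leNgt invr_gt0 ltr0n.
split=> [x y|].
  by rewrite /dist (_ : term x y = term y x)//; apply/funext => n; rewrite /term distrC.
split=> [x y z|U].
  apply: dist_le => n; apply: le_trans (lerD (term_le x y n) (term_le y z n)).
  have := ler_distD (h n y) (h n x) (h n z).
  have : (0 : R) <= n.+1%:R^-1 by rewrite invr_ge0 ler0n.
  have := normr_ge0 (h n x - h n y); have := normr_ge0 (h n y - h n z).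
  rewrite /term; move: (n.+1%:R^-1) => c.
  by rewrite /Num.min; case: ifP; case: ifP; case: ifP; lra.
split=> [oU x Ux|ballU].
  (* If no ball around [x] fits into [U], points outside [U] at distances tending to 0 cluster by
     compactness at some [z] outside [U]; each [h n] takes the same value at [z] and [x], so
     [z = x]. *)
  apply: contrapT => nU.
  have /choice[y Hy] n : exists y, dist x y < n.+1%:R^-1 /\ ~ U y.
    apply: contrapT => ny; apply: nU; exists n.+1%:R^-1; first by rewrite invr_gt0.
    by move=> y xy; apply: contrapT => Uy; apply: ny; exists y.
  have [z [_ clz]] := cX (fmap_proper_filter y eventually_filter) filterT.
  have nUz : ~ U z.
    have F0 : (y @ \oo) [set w | ~ U w] by exists 0%N => // n _; case: (Hy n).
    by move=> Uz; have [w []] := clz _ _ F0 (open_nbhs_nbhs (conj oU Uz)).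
  apply: nUz; rewrite (_ : z = x)//; apply: sep => n; apply/eqP.
  apply: contrapT => /negP nzx.
  pose e := `|h n x - h n z|.
  have e0 : 0 < e / 2 by rewrite divr_gt0// normr_gt0 subr_eq0 eq_sym.
  (* Below [n.+1%:R^-1] the truncation is inactive, so such a distance bounds the difference of the
     values of [h n] itself. *)
  have m0 : 0 < Num.min (e / 2) n.+1%:R^-1 by rewrite lt_min e0 invr_gt0 ltr0n.
  have [N] := ltr_add_invr m0; rewrite add0r => Ne.
  have F0 : (y @ \oo) [set w | `|h n x - h n w| < e / 2].
    exists N => // m /= Nm; have [ym _] := Hy m.
    have : dist x (y m) < Num.min (e / 2) n.+1%:R^-1.
      apply: (lt_trans ym); apply: le_lt_trans Ne.
      by rewrite lef_pV2 ?posrE ?ltr0n// ler_nat ltnS.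
    rewrite lt_min => /andP[de dn].
    have := le_lt_trans (term_le x (y m) n) dn.
    rewrite gt_min ltxx /= => tn.
    have := term_le x (y m) n; rewrite /term min_r ?(ltW tn)// => /le_lt_trans; exact.
  have Z0 : nbhs z [set w | `|h n z - h n w| < e / 2].
    by have /cvgrPdist_lt : h n w @[w --> z] --> h n z := @ch n z; apply.
  have [w [/= xw zw]] := clz _ _ F0 Z0.
  have := ler_distD (h n w) (h n x) (h n z); move: xw zw.
  by rewrite [`|h n z - _|]distrC -/e; lra.
rewrite openE => x /ballU[e e0 sU]; apply: filterS sU _.
exact: dist_nbhs.
Qed.

End SeparatingSequenceMetric.

Lemma continuous_coordinate (R : realType) (K : Type) (X : topologicalType)
  (f : X -> prod_topology (fun _ : K => R^o)) (k : K) :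
  continuous f -> continuous (fun x => f x k : R^o).
Proof.
move=> cf x; have := @proj_continuous {classic K} (fun=> R^o) k (f x).
exact: (@continuous_comp _ _ _ f (fun g => g k) x (cf x)).
Qed.

Lemma open_borel (X : ptopologicalType) (U : set X) :
  open U -> measurable (U : set (borel_type X)).
Proof. by move=> oU; apply: sub_sigma_algebra. Qed.

Lemma metrizable_of_countable_coordinates (R : realType) (K : Type)
  (X : topologicalType) (f : X -> prod_topology (fun _ : K => R^o)) :
  compact [set: X] -> continuous f -> injective f ->
  countable [set k | exists x, f x k != 0] -> metrizable R X.
Proof.
move=> cX cf injf /countable_injP[g ginj].
pose P n k := (exists x, f x k != 0) /\ g k = n.
(* [h n] is the coordinate with code [n], or 0 if there is none. The coordinates outside the
   countable set vanish identically and separate no points. *)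
have /choice[h Hh] n : exists h : X -> R^o, continuous h /\
    forall k, P n k -> h = (fun x => f x k).
  case: (pselect (exists k, P n k)) => [[k [xk gk]]|nk].
    exists (fun x => f x k); split; first exact: continuous_coordinate.
    move=> k' [xk' gk']; suff -> : k = k' by [].
    by apply: ginj; rewrite ?inE// gk.
  exists (fun=> 0); split; first by move=> x; exact: cst_continuous.
  by move=> k Pk; exfalso; apply: nk; exists k.
apply: (@metrizable_of_separating_sequence _ _ h) => //.
  by move=> n; case: (Hh n).
move=> x y xy; apply: injf; apply: functional_extensionality_dep => k.
case: (pselect (exists x, f x k != 0)) => [xk|nk].
  by have [_ /(_ k (conj xk erefl)) hE] := Hh (g k); have := xy (g k); rewrite hE.
have z0 z : f z k = 0 by apply/eqP; apply: contrapT => /negP zk; apply: nk; exists z.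
by rewrite !z0.
Qed.

Lemma MA_corson_metrizable (R : realType) :
  MA_omega1_measure_algebras R -> corson_positive_measure_metrizable R.
Proof.
move=> MA X [cX [hX [K [f [[cf [injf _]] fS]]]]] [mu [_ posmu]].
apply: (metrizable_of_countable_coordinates cX cf injf).
apply: contrapT => ncS.
have [I IS aI] := uncountable_has_aleph1 ncS.
have ck k : continuous (fun x => f x k : R^o) by exact: continuous_coordinate.
pose C k n := [set x | n.+1%:R^-1 <= `|f x k|].
have clC k n : closed (C k n).
  have /continuous_closedP/(_ _ (@closed_ge R n.+1%:R^-1)) :
      continuous (fun x => `|f x k| : R^o).
    by move=> x; apply: cvg_norm; exact: ck.
  by [].
have mC k n : measurable (C k n : set (borel_type X)).
  by rewrite -[C k n]setCK; apply: measurableC; apply: open_borel; exact: closed_openC.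
(* The sets [C k n] exhaust the open set where coordinate [k] is non-zero; it is non-empty, hence of
   positive measure, so one of them is not null. *)
have /choice[n0 Hn0] (i : {k | I k}) :
    exists n, (0 < mu (C (sval i) n : set (borel_type X)))%E.
  apply: contrapT => nn.
  have [x0 x0i] := IS _ (svalP i).
  pose U : set X := [set x | f x (sval i) != 0].
  have oU : open U.
    by have /continuousP/(_ _ (@open_neq R 0)) := ck (sval i).
  have := posmu U oU; rewrite lt0e => /(_ _)/andP[|/eqP[]]; first by exists x0.
  apply: (@subset_measure0 _ _ _ mu (U : set (borel_type X))
    (\bigcup_n (C (sval i) n : set (borel_type X)))).
  - exact: open_borel.
  - exact: bigcupT_measurable.
  - move=> x Ux; have xi0 : 0 < `|f x (sval i)| by rewrite normr_gt0.
    by have [n] := ltr_add_invr xi0; rewrite add0r => /ltW ?; exists n.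
  - apply: null_bigcup => // n; apply: contrapT => /eqP h; apply: nn; exists n.
    exact: measure_gt0.
have [J [ncJ centJ]] := MA_precaliber MA (mu := mu) aI
  (A := fun i => C (sval i) (n0 i)) (fun i => conj (mC _ _) (Hn0 i)).
have [z [Uz [zC _]]] := centered_ultrafilter (fun i _ => mC (sval i) (n0 i)) centJ.
(* A limit of [z] lies in every closed set of the centered family, so all coordinates indexed by [J]
   are non-zero at [x]. *)
have : compact [set: X] := cX; rewrite compact_ultra => /(_ z Uz filterT)[x [_ zx]].
apply: ncJ; apply: (@countableS _ _ [set i | f x (sval i) != 0]).
  move=> i Ji; have Cx : C (sval i) (n0 i) x.
    apply: clC => B Bx; exact: (filter_ex (filterI (zC i Ji) (zx B Bx))).
  by rewrite /= -normr_gt0; apply: lt_le_trans Cx; rewrite invr_gt0.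
have /countable_injP[g ginj] : countable [set k | f x k != 0] by apply: fS; exists x.
apply/countable_injP; exists (g \o sval) => a b; rewrite !inE /= => ax bx gab.
have : sval a = sval b by apply: ginj; rewrite ?inE.
by case: a b {ax bx gab} => a Ia [b Ib] /= ab; subst b; rewrite (Prop_irrelevance Ia Ib).
Qed.

(** * The Stone space of a family of measurable sets *)

(** The pattern [x] chooses a side of each [A i]; for finite [F] the non-empty cylinders are the
    atoms of the algebra generated by the [A i] with [i] in [F]. *)
Definition cyl (I T : Type) (A : I -> set T) (F : set I) (x : I -> bool) : set T :=
  \bigcap_(i in F) (if x i then A i else ~` A i).

Section Cylinders.
Context {I T : Type} (A : I -> set T).

Lemma cylU F F' x : cyl A (F `|` F') x = cyl A F x `&` cyl A F' x.
Proof. exact: bigcap_setU. Qed.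

Lemma eq_cyl F x y : (forall i, F i -> x i = y i) -> cyl A F x = cyl A F y.
Proof. by move=> xy; apply: eq_bigcapr => i Fi; rewrite xy. Qed.

Lemma cyl_agree F F' x y t : cyl A F x t -> cyl A F' y t ->
  forall i, F i -> F' i -> x i = y i.
Proof.
by move=> xt yt i Fi F'i; move: (xt i Fi) (yt i F'i); case: (x i); case: (y i).
Qed.

Lemma measurable_cyl (d : measure_display) (U : measurableType d)
  (B : I -> set U) F x : (forall i, measurable (B i)) -> finite_set F ->
  measurable (cyl B F x).
Proof.
move=> mB finF; apply: fin_bigcap_measurable => // i _.
by case: (x i) => //; exact: measurableC.
Qed.

End Cylinders.

(* The Stone space of the algebra generated by the classes of the [A i]. *)
Definition pattern_space (R : realType) (d : measure_display)
    (T : measurableType d) (mu : probability T R) (I : Type) (A : I -> set T)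
    (mA : forall i, measurable (A i)) : Type :=
  {x : I -> bool | forall F, finite_set F -> (0 < mu (cyl A F x))%E}.

Section PatternSpace.
Context {R : realType} {d : measure_display} {T : measurableType d}.
Context (mu : probability T R) {I : Type} (A : I -> set T).
Context (mA : forall i, measurable (A i)).
Local Notation X := (pattern_space mu mA).
Local Notation cyl := (cyl A).
Implicit Types (x y : X) (F : set I) (z : set_system T).

Let mcyl F (x : I -> bool) : finite_set F -> measurable (cyl F x).
Proof. exact: measurable_cyl. Qed.

Let val_inj x y : sval x =1 sval y -> x = y.
Proof.
case: x y => x xP [y yP] /= /funext xy; subst y.
by rewrite (Prop_irrelevance xP yP).
Qed.

(** The point records which [A i] belong to [z]; its cylinders are members of [z], hence not null.
    Points with prescribed behaviour are produced in this way from sets of positive measure. *)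
Lemma pattern_of_ultrafilter z : UltraFilter z ->
  (forall N, measurable N -> mu N = 0%E -> z (~` N)) ->
  exists x, forall F, finite_set F -> z (cyl F (sval x)).
Proof.
move=> Uz zN; pose x i := `[< z (A i) >].
have zx F : finite_set F -> z (cyl F x).
  elim/finite_set_ind : F / => [|i F _ IH].
    by rewrite /cyl bigcap_set0; exact: filterT.
  rewrite /cyl bigcap_setU1; apply: filterI => //.
  rewrite /x; case: asboolP => // nzA.
  by case: (in_ultra_setVsetC (A i) Uz).
have x_pos F : finite_set F -> (0 < mu (cyl F x))%E.
  move=> finF; apply: measure_gt0; first exact: mcyl.
  apply/eqP => F0; have := zN _ (mcyl x finF) F0.
  by move=> /(filterI (zx F finF)); rewrite setICr; exact: filter_not_empty.
by exists (exist _ x x_pos).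
Qed.

Let pattern_inhabited : exists x : X, True.
Proof.
have [|z [Uz [_ zN]]] := @ultrafilter_of_positive _ _ _ mu setT measurableT.
  by rewrite probability_setT.
by have [x _] := pattern_of_ultrafilter Uz zN; exists x.
Qed.

(** * The topology of agreement on finite sets of indices *)

HB.instance Definition _ := gen_eqMixin X.
HB.instance Definition _ := gen_choiceMixin X.
HB.instance Definition _ := isPointed.Build X (projT1 (cid pattern_inhabited)).

Definition agree F x : set X := [set y | forall i, F i -> sval y i = sval x i].

Definition pattern_nbhs x : set_system X :=
  [set B | exists2 F, finite_set F & agree F x `<=` B].

HB.instance Definition _ := hasNbhs.Build X pattern_nbhs.

Let pattern_nbhs_filter x : ProperFilter (nbhs x).
Proof.
apply: Build_ProperFilter_ex; first by move=> B [F _ FB]; exists x; exact: FB.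
split; first by exists set0.
- move=> B C [F finF FB] [F' finF' FC]; exists (F `|` F').
    by rewrite finite_setU.
  move=> y xy; split; [apply: FB|apply: FC] => i Fi; apply: xy; [left|right]; exact: Fi.
- by move=> B C BC [F finF FB]; exists F => //; exact: subset_trans BC.
Qed.

Let pattern_nbhs_singleton x (B : set X) : nbhs x B -> B x.
Proof. by move=> [F _]; apply. Qed.

Let agree_agree F x y : agree F x y -> agree F y = agree F x.
Proof.
by move=> xy; apply/seteqP; split=> w h i Fi; rewrite h// xy.
Qed.

Let pattern_nbhs_nbhs x (B : set X) : nbhs x B -> nbhs x (nbhs^~ B).
Proof.
move=> [F finF FB]; exists F => // y xy; exists F => //.
by rewrite (agree_agree xy).
Qed.

HB.instance Definition _ := Nbhs_isNbhsTopological.Build X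
  pattern_nbhs_filter pattern_nbhs_singleton pattern_nbhs_nbhs.

Lemma pattern_nbhsE x (B : set X) :
  nbhs x B <-> exists2 F, finite_set F & agree F x `<=` B.
Proof. by []. Qed.

(** The pointwise limit of an ultrafilter is again a point of the space: on each finite [F] it
    agrees with some point, so its cylinder over [F] has positive measure. *)
Lemma pattern_compact : compact [set: X].
Proof.
rewrite compact_ultra => W UW _.
pose x i := `[< W [set y : X | sval y i] >].
have Wx F : finite_set F -> W [set y : X | forall i, F i -> sval y i = x i].
  elim/finite_set_ind : F / => [|i F _ IH]; first by apply: filterE => y i [].
  have Wi : W [set y : X | sval y i = x i].
    rewrite /x; case: asboolP => // nW.
    have [//|] := in_ultra_setVsetC [set y : X | sval y i] UW.
    by apply: filterS => y /negP/negbTE.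
  by apply: filterS (filterI Wi IH) => y [/= yi yF] j [->|/yF].
have x_pos F : finite_set F -> (0 < mu (cyl F x))%E.
  move=> finF; have [y yx] := filter_ex (Wx F finF).
  by rewrite -(eq_cyl A yx); exact: (svalP y).
exists (exist _ x x_pos); split=> // B [F finF FB].
exact: filterS FB (Wx F finF).
Qed.

Lemma pattern_hausdorff : hausdorff_space X.
Proof.
move=> x y xy; apply: val_inj => i.
have [||w [/(_ i erefl) <- /(_ i erefl)//]] := xy (agree [set i] x) (agree [set i] y).
- by exists [set i].
- by exists [set i].
Qed.

Lemma pattern_continuous (K : topologicalType) i (a b : K) :
  continuous (fun x : X => if sval x i then a else b).
Proof.
move=> x; apply: (@near_cst_continuous _ _ (if sval x i then a else b)).
suff : nbhs x [set y : X | (if sval y i then a else b) = if sval x i then a else b].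
  by [].
by exists [set i] => // y /(_ i erefl) /= ->.
Qed.

(** This says that the class of [C] belongs to the filter which the cylinders of [x] generate in the
    measure algebra. *)
Definition covers (C : set T) (x : I -> bool) :=
  exists2 F, finite_set F & mu (cyl F x `\` C) = 0%E.

Lemma covers_sub (C : set T) F x : finite_set F -> cyl F (sval x) `<=` C ->
  covers C (sval x).
Proof.
move=> finF FC; exists F => //; rewrite (_ : _ `\` _ = set0) ?measure0//.
by apply/seteqP; split=> t // [/FC].
Qed.

Lemma coversS (C C' : set T) (x : I -> bool) : measurable C -> measurable C' ->
  C `<=` C' -> covers C x -> covers C' x.
Proof.
move=> mC mC' CC' [F finF F0]; exists F => //.
have mF := mcyl x finF.
by apply: subset_measure0 F0; [exact: measurableD|exact: measurableD|exact: setDS].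
Qed.

Lemma coversI (C C' : set T) (x : I -> bool) : measurable C -> measurable C' ->
  covers C x -> covers C' x -> covers (C `&` C') x.
Proof.
move=> mC mC' [F finF F0] [F' finF' F'0]; exists (F `|` F').
  by rewrite finite_setU.
have mF := mcyl x finF; have mF' := mcyl x finF'.
rewrite cylU; apply: (@subset_measure0 _ _ _ mu _
  ((cyl F x `\` C) `|` (cyl F' x `\` C'))).
- by apply: measurableD; exact: measurableI.
- by apply: measurableU; exact: measurableD.
- move=> t [[Ft F't] nt]; case: (pselect (C t)) => Ct; last by left.
  by right; split=> // C't; exact: nt.
- by apply: null_setU => //; exact: measurableD.
Qed.

Lemma agree_covers F x y : finite_set F -> agree F x y ->
  covers (cyl F (sval x)) (sval y).
Proof. by move=> finF xy; apply: (covers_sub finF); rewrite (eq_cyl A xy). Qed.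

(** One index of disagreement suffices. Together with [agree_covers], every point decides every
    finite cylinder, which makes the basic sets Caratheodory measurable. *)
Lemma disagree_covers F x y : ~ agree F x y ->
  covers (~` cyl F (sval x)) (sval y).
Proof.
move=> /existsNP[i /not_implyP[Fi nxy]].
apply: (@covers_sub _ [set i]) => // t yt xt.
by apply: nxy; exact: (cyl_agree yt xt).
Qed.

(** * The outer measure and its measurable sets *)

Local Open Scope ereal_scope.

Definition pattern_outer (E : set X) : \bar R :=
  ereal_inf [set mu C | C in
    [set C | measurable C /\ forall x, E x -> covers C (sval x)]].

Lemma pattern_outer_le (E : set X) (C : set T) : measurable C ->
  (forall x, E x -> covers C (sval x)) -> pattern_outer E <= mu C.
Proof. by move=> mC cC; apply: ereal_inf_lbound; exists C. Qed.

Lemma pattern_outer_ge (E : set X) (a : \bar R) :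
  (forall C, measurable C -> (forall x, E x -> covers C (sval x)) -> a <= mu C) ->
  a <= pattern_outer E.
Proof. by move=> h; apply: le_ereal_inf_tmp => _ [C [mC cC] <-]; exact: h. Qed.

Let pattern_outer0 : pattern_outer set0 = 0.
Proof.
apply/eqP; rewrite eq_le; apply/andP; split; last by apply: pattern_outer_ge.
by rewrite -(measure0 mu); apply: pattern_outer_le.
Qed.

Let pattern_outer_ge0 E : 0 <= pattern_outer E.
Proof. exact: pattern_outer_ge. Qed.

Let le_pattern_outer : {homo pattern_outer : E E' / E `<=` E' >-> E <= E'}.
Proof.
move=> E E' EE'; apply: pattern_outer_ge => C mC cC.
by apply: pattern_outer_le => // x /EE'; exact: cC.
Qed.

Let pattern_outer_fin E : pattern_outer E \is a fin_num.
Proof.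
rewrite ge0_fin_numE//; apply: (@le_lt_trans _ _ (mu setT)).
  by apply: pattern_outer_le => // x _; apply: (@covers_sub _ set0).
by rewrite probability_setT ltry.
Qed.

Let pattern_outer_sigma_subadditive : sigma_subadditive pattern_outer.
Proof.
move=> E; apply/lee_addgt0Pr => e e0.
have /choice[C HC] n : exists C, [/\ measurable C,
    forall x, E n x -> covers C (sval x) &
    mu C <= pattern_outer (E n) + (e / (2 ^ n.+1)%:R)%:E].
  have en : (0 < e / (2 ^ n.+1)%:R)%R by rewrite divr_gt0// ltr0n expn_gt0.
  have [_ [C [mC cC] <-] /ltW le] := lb_ereal_inf_adherent en (pattern_outer_fin (E n)).
  by exists C.
have mC n : measurable (C n) by case: (HC n).
have mU : measurable (\bigcup_n C n) by exact: bigcupT_measurable.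
apply: (@le_trans _ _ (mu (\bigcup_n C n))).
  apply: pattern_outer_le => // x [n _ Enx]; have [_ cC _] := HC n.
  by apply: (coversS (mC n)) (cC x Enx) => //; exact: bigcup_sup.
apply: le_trans (epsilon_trick xpredT _ (ltW e0)); last by move=> n.
apply: (le_trans (generalized_Boole_inequality mu mC mU)).
by apply: lee_nneseries => n _ //; case: (HC n).
Qed.

HB.instance Definition _ := isOuterMeasure.Build R X pattern_outer
  pattern_outer0 pattern_outer_ge0 le_pattern_outer
  pattern_outer_sigma_subadditive.

(** A set [C] that covers [E] is cut by [D] into two sets covering the parts of [E] inside and
    outside [U], and [mu] is additive on this cut. *)
Let carath_covers (U : set X) (D : set T) : measurable D ->
  (forall x, U x -> covers D (sval x)) ->
  (forall x, ~ U x -> covers (~` D) (sval x)) ->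
  pattern_outer.-caratheodory U.
Proof.
move=> mD cD cnD; apply: le_caratheodory_measurable => E.
apply: pattern_outer_ge => C mC cC.
rewrite (measureDI mu mC mD) addeC; apply: leeD; apply: pattern_outer_le.
- exact: measurableD.
- by move=> x [Ex nUx]; apply: coversI; auto; exact: measurableC.
- exact: measurableI.
- by move=> x [Ex Ux]; apply: coversI; auto.
Qed.

Let carath_agree F x : finite_set F -> pattern_outer.-caratheodory (agree F x).
Proof.
move=> finF; apply: (@carath_covers _ (cyl F (sval x))); first exact: mcyl.
- by move=> y; exact: agree_covers.
- by move=> y; exact: disagree_covers.
Qed.

Let carath_null (N : set X) : pattern_outer N = 0 -> pattern_outer.-caratheodory N.
Proof.
move=> N0; apply: le_caratheodory_measurable => E.
have EN : pattern_outer (E `&` N) <= 0.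
  by rewrite -N0; apply: le_pattern_outer; exact: subIsetr.
have EN' : pattern_outer (E `&` ~` N) <= pattern_outer E.
  by apply: le_pattern_outer; exact: subIsetl.
by have := leeD EN EN'; rewrite add0e.
Qed.

(* An open set is the union of countably many of the basic sets it contains,
   chosen so as to exhaust its measure, and of an outer-null remainder. *)
Lemma carath_open (U : set X) : open U -> pattern_outer.-caratheodory U.
Proof.
move=> oU.
have nbU x : U x -> exists2 F, finite_set F & agree F x `<=` U.
  by move=> Ux; apply/pattern_nbhsE; exact: (open_nbhs_nbhs (conj oU Ux)).
have [->|U0] := eqVneq U set0; first exact: caratheodory_measurable_set0.
move/set0P : U0 => [x0 Ux0].
pose P := [set C | exists F x, [/\ finite_set F, agree F x `<=` U & C = cyl F (sval x)]].
have [_ [F [x [finF _ ->]]]||C [PC nC]] := @essential_union _ _ _ mu P.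
- exact: mcyl.
- by have [F finF FU] := nbU x0 Ux0; exists (cyl F (sval x0)), F, x0.
have /choice[p Hp] n : exists p : set I * X, [/\ finite_set p.1,
    agree p.1 p.2 `<=` U & C n = cyl p.1 (sval p.2)].
  by have [F [x h]] := PC n; exists (F, x).
pose V := \bigcup_n agree (p n).1 (p n).2.
have VU : V `<=` U by move=> x [n _]; case: (Hp n) => _ + _; apply.
have cV : pattern_outer.-caratheodory V.
  by apply: caratheodory_measurable_bigcup => n; apply: carath_agree; case: (Hp n).
suff N0 : pattern_outer (U `\` V) = 0.
  rewrite -(setDUK VU); apply: caratheodory_measurable_setU => //.
  exact: carath_null.
have mC n : measurable (C n) by case: (Hp n) => finF _ ->; exact: mcyl.
have mUC : measurable (\bigcup_n C n) by exact: bigcupT_measurable.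
(* A point of [U] outside [V] is covered by the whole union, and by the complement of each [C i]
   because it disagrees with the pattern of [C i]. So each [D k] covers the remainder, and
   [mu (D k)] tends to 0. *)
pose D k := \bigcup_n C n `\` \bigcup_(i < k) C i.
have mD k : measurable (D k).
  by apply: measurableD => //; exact: bigcup_measurable.
have D0 : \bigcap_k D k = set0.
  apply/seteqP; split=> // t tD; have [[n _ Cnt] _] := tD 0%N Logic.I.
  by have [_] := tD n.+1 Logic.I; apply; exists n => /=.
have cvD : mu (D k) @[k --> \oo] --> mu set0.
  rewrite -D0; apply: nonincreasing_cvg_mu => //.
  - by rewrite ltey_eq fin_num_measure.
  - exact: bigcap_measurable.
  - move=> m n mn; apply/subsetPset; apply: setDS => t [i /= im Cit].
    by exists i => //=; exact: leq_trans mn.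
apply/eqP; rewrite eq_le pattern_outer_ge0 andbT.
rewrite measure0 in cvD; apply: (cvge_to_ge cvD); apply: nearW => k.
apply: pattern_outer_le => // y [Uy nVy].
have cyC : covers (\bigcup_n C n) (sval y).
  have [F finF FU] := nbU y Uy; exists F => //.
  by apply: nC; exists F, y.
have -> : D k = \bigcup_n C n `&` ~` (\bigcup_(i < k) C i) by rewrite -setDE.
elim: k => [|k IH].
  by rewrite bigcup_mkord big_ord0 setC0 setIT.
rewrite bigcup_mkord big_ord_recr -bigcup_mkord setCU setIA.
apply: coversI => //; [exact: mD|exact: measurableC|].
have [finF _ ->] := Hp k; apply: disagree_covers => yk.
by apply: nVy; exists k.
Qed.

Let carath_borel (B : set (borel_type X)) :
  measurable B -> pattern_outer.-caratheodory B.
Proof.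
move: B; apply: smallest_sub; last by move=> U; exact: carath_open.
split; first exact: caratheodory_measurable_set0.
- by move=> E cE; rewrite setTD; exact: caratheodory_measurable_setC.
- by move=> E cE; exact: caratheodory_measurable_bigcup.
Qed.

(** For the lower bound, if [C] missed a positive part of the cylinder, an ultrafilter on that part
    would yield a point of [agree F x] that [C] does not cover. *)
Lemma pattern_outer_agree F x : finite_set F ->
  pattern_outer (agree F x) = mu (cyl F (sval x)).
Proof.
move=> finF; have mF := mcyl (sval x) finF.
apply/eqP; rewrite eq_le; apply/andP; split.
  by apply: pattern_outer_le => // y; exact: agree_covers.
apply: pattern_outer_ge => C mC cC; apply: le_measure_null => //.
have mD : measurable (cyl F (sval x) `\` C) by exact: measurableD.
apply: contrapT => /eqP /(measure_gt0 mD) D0.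
have [z [Uz [zD zN]]] := ultrafilter_of_positive mD D0.
have [y zy] := pattern_of_ultrafilter Uz zN.
have xy : agree F x y.
  move=> i Fi; have [t [yt [xt _]]] := filter_ex (filterI (zy F finF) zD).
  exact: (cyl_agree yt xt).
have [F' finF' F'0] := cC y xy; have mF' := mcyl (sval y) finF'.
have zF' := zN _ (measurableD mF' mC) F'0.
have [t [[yt nt] [_ Ct]]] := filter_ex (filterI (filterI (zy F' finF') zF') zD).
exact: nt.
Qed.

(** * The strictly positive Radon probability measure *)

Definition pattern_measure (B : set (borel_type X)) : \bar R := pattern_outer B.

Let pattern_measure0 : pattern_measure set0 = 0. Proof. exact: pattern_outer0. Qed.

Let pattern_measure_ge0 B : 0 <= pattern_measure B.
Proof. exact: pattern_outer_ge0. Qed.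

Let pattern_measure_sigma_additive : semi_sigma_additive pattern_measure.
Proof.
move=> B mB tB mUB.
apply: (@caratheodory_measure_sigma_additive R X pattern_outer B) => //.
- by move=> n; exact: carath_borel.
- exact: carath_borel.
Qed.

HB.instance Definition _ := isMeasure.Build _ (borel_type X) R pattern_measure
  pattern_measure0 pattern_measure_ge0 pattern_measure_sigma_additive.

Let pattern_measureT : pattern_measure setT = 1.
Proof.
have [x _] := pattern_inhabited.
rewrite /pattern_measure (_ : setT = agree set0 x); last first.
  by apply/seteqP; split=> // y _ i [].
rewrite pattern_outer_agree// /cyl -(probability_setT mu).
by congr (mu _); exact: bigcap_set0.
Qed.

HB.instance Definition _ := Measure_isProbability.Build _ (borel_type X) R
  pattern_measure pattern_measureT.

Lemma pattern_measure_strictly_positive :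
  strictly_positive (pattern_measure : probability _ R).
Proof.
move=> U oU [x Ux].
have : nbhs x U := open_nbhs_nbhs (conj oU Ux).
move=> /pattern_nbhsE[F finF FU]; apply: (lt_le_trans (svalP x F finF)).
by rewrite -pattern_outer_agree//; exact: le_pattern_outer.
Qed.

(* The points covered by a given set form an open set, which gives outer
   regularity, and inner regularity by complementation. *)
Lemma pattern_measure_radon : radon (pattern_measure : probability _ R).
Proof.
move=> B mB; apply/eqP; rewrite eq_le; apply/andP; split; last first.
  apply: ge_ereal_sup => _ [K [_ KB] <-]; exact: le_pattern_outer.
apply/lee_addgt0Pr => e e0.
have [_ [C [mC cC] <-] Ce] := lb_ereal_inf_adherent e0 (pattern_outer_fin (~` B)).
pose U : set X := [set x : X | covers C (sval x)].
have oU : open U.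
  (* One finite [F] witnesses the covering, and points that agree on [F] have the same cylinder over
     [F]. *)
  rewrite openE => x [F finF F0]; apply/pattern_nbhsE; exists F => // y xy.
  by exists F => //; rewrite (eq_cyl A xy).
have mU : measurable (U : set (borel_type X)) by exact: open_borel.
have cU : compact (~` U).
  apply: (@subclosed_compact _ _ setT) => //; first exact: open_closedC.
  exact: pattern_compact.
have UB : ~` U `<=` B.
  by move=> x nUx; apply: contrapT => nBx; apply: nUx; exact: cC.
apply: (@le_trans _ _ (pattern_measure (~` U) + e%:E)); last first.
  by rewrite leeD2r//; apply: ereal_sup_ubound; exists (~` U).
have UC : pattern_measure U <= mu C by exact: pattern_outer_le.
have CB : mu C <= pattern_measure (~` B) + e%:E by exact: ltW.
have cE (E : set (borel_type X)) : measurable E ->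
    pattern_measure (~` E) = 1 - pattern_measure E.
  exact: (@probability_setC _ _ _ (pattern_measure : probability _ R)).
have := le_trans UC CB; rewrite (cE U mU) (cE B mB).
suff : pattern_measure U <= 1 - pattern_measure B + e%:E ->
  pattern_measure B <= 1 - pattern_measure U + e%:E by [].
have : pattern_measure B \is a fin_num by exact: pattern_outer_fin.
have : pattern_measure U \is a fin_num by exact: pattern_outer_fin.
move: (pattern_measure B) (pattern_measure U) => [b| |] [u| |]// _ _.
by rewrite -!EFinB -!EFinD !lee_fin; lra.
Qed.

End PatternSpace.

(** * Non-metrizability and dense families *)

Lemma compact_embedding (X Y : topologicalType) (f : X -> Y) :
  compact [set: X] -> hausdorff_space Y -> continuous f -> injective f ->
  embedding f.
Proof.
move=> cX hY cf injf; split=> //; split=> // U oU.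
have cfU : compact (f @` (~` U)).
  apply: continuous_compact; first exact: continuous_subspaceT.
  by apply: subclosed_compact cX _ => //; exact: open_closedC.
exists (~` (f @` (~` U))); split; first exact: closed_openC (compact_closed hY cfU).
apply/seteqP; split=> [_ [x Ux <-]|_ [[x _ <-] nUx]].
  split; first by exists x.
  by case=> y + /injf yx; rewrite yx; apply.
by exists x => //; apply: contrapT => Ux; apply: nUx; exists x.
Qed.

Lemma compact_metrizable_separable (R : realType) (X : ptopologicalType) :
  compact [set: X] -> metrizable R X ->
  exists2 D : set X, countable D &
    forall U, open U -> U !=set0 -> U `&` D !=set0.
Proof.
move=> cX [dist [d0 [d00 [dsym [dtri dopen]]]]].
pose ball x n := [set y | dist x y < n.+1%:R^-1 :> R].
have oball x n : open (ball x n).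
  apply/dopen => y xy; exists (n.+1%:R^-1 - dist x y); first by rewrite subr_gt0.
  move=> w /= yw; apply: le_lt_trans (dtri x y w) _.
  by rewrite -ltrBrDl.
have /choice[D HD] n : exists D : set X, finite_set D /\
    forall y, exists2 x, D x & ball x n y.
  move: cX; rewrite compact_cover => /(_ X setT (fun x => ball x n))[||D _ cD].
  - by move=> x _; exact: oball.
  - by move=> x _; exists x => //; rewrite /ball /= (d00 x x).2// invr_gt0.
  - have [D' [finD' cD']] : exists D' : set X,
        finite_set D' /\ setT `<=` cover D' (fun x => ball x n).
      by eexists; split; last exact: cD; exact: finite_fset.
    exists D'; split=> // y.
    by have [x Dx xy] := cD' y Logic.I; exists x.
exists (\bigcup_n D n).
  by apply: bigcup_countable => // n _; apply: finite_set_countable; case: (HD n).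
move=> U oU [y Uy]; have [e e0 yU] := (dopen U).1 oU y Uy.
have [n] := ltr_add_invr e0; rewrite add0r => ne.
have [x Dx xy] := (HD n).2 y; exists x; split; last by exists n.
by apply: yU; rewrite /= dsym; exact: lt_trans ne.
Qed.

Section PatternSpaceCorson.
Context {R : realType} {d : measure_display} {T : measurableType d}.
Context (mu : probability T R) {I : Type} (A : I -> set T).
Context (mA : forall i, measurable (A i)).
Local Notation X := (pattern_space mu mA).
Hypothesis centered_countable : forall J : set I,
  (forall F, finite_set F -> F `<=` J -> (0 < mu (\bigcap_(i in F) A i))%E) ->
  countable J.

(** Over a finite part of the support the cylinder of [x] is the intersection of the sets [A i], so
    the support indexes a centered family. *)
Lemma pattern_support_countable (x : X) : countable [set i | sval x i].
Proof.
apply: centered_countable => F finF Fx; have := svalP x F finF.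
rewrite (_ : cyl A F (sval x) = \bigcap_(i in F) A i)//.
by apply: eq_bigcapr => i /Fx /= ->.
Qed.

Lemma pattern_corson : corson_compactum R X.
Proof.
split; first exact: pattern_compact.
split; first exact: pattern_hausdorff.
pose f (x : X) : prod_topology (fun _ : I => R^o) := fun i => if sval x i then 1 else 0.
exists I, f; split.
  apply: compact_embedding; first exact: pattern_compact.
  - apply: (@hausdorff_product {classic I} (fun=> R^o)) => _.
    exact: Rhausdorff.
  - move=> x; have FF : Filter (fmap f (nbhs x)).
      by apply: fmap_filter; exact: nbhs_filter.
    apply/cvg_sup => i.
    apply: (@continuous_comp_initial (prod_topology (fun _ : I => R^o)) X R^o
      (fun g => g i) f).
    exact: pattern_continuous.
  - move=> x y xy; have {xy} : sval x = sval y.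
      apply/funext => i; have := congr1 (fun g => g i) xy; rewrite /f.
      case: (sval x i); case: (sval y i) => // /eqP; rewrite ?oner_eq0//.
      by rewrite eq_sym oner_eq0.
    by case: x y => x xP [y yP] /= xy; subst y; rewrite (Prop_irrelevance xP yP).
move=> _ [x _ <-]; rewrite /Sigma_prod /=.
apply: countableS (pattern_support_countable x) => i /=.
by rewrite /f; case: (sval x i); rewrite ?eqxx.
Qed.

(** A countable dense set would meet the non-empty open set of points with value true at [i], for
    every [i], and so cover [I] by countably many countable supports. *)
Lemma pattern_not_metrizable : ~ countable [set: I] ->
  (forall i, 0 < mu (A i))%E -> ~ metrizable R X.
Proof.
move=> ncI A0 metX.
have cX := @pattern_compact _ _ _ mu _ _ mA.
have [D cD denseD] := compact_metrizable_separable cX metX.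
apply: ncI; apply: (@countableS _ _ (\bigcup_(x in D) [set i | sval x i])).
  move=> i _; have [||x [xi Dx]] := denseD [set x : X | sval x i].
  - rewrite openE => x xi; apply/pattern_nbhsE; exists [set i] => // y.
    by move=> /(_ i erefl) /= ->.
  - have [z [Uz [zA zN]]] := ultrafilter_of_positive (mA i) (A0 i).
    have [x zx] := @pattern_of_ultrafilter _ _ _ _ _ _ mA _ Uz zN; exists x => /=.
    have [t [/(_ i erefl)]] := filter_ex (filterI (zx [set i] (finite_set1 i)) zA).
    by case: (sval x i).
  - by exists x.
by apply: bigcup_countable => // x _; exact: pattern_support_countable.
Qed.

End PatternSpaceCorson.

Section DenseFamilies.
Context {R : realType} {d : measure_display} {T : measurableType d}.
Variable mu : probability T R.
Local Open Scope ereal_scope.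

(** Take the essential union of [D]. If its complement were positive, a member of [D] below that
    complement would also lie below the union, hence be null. *)
Lemma dense_countable_cover (D : set (set T)) : ma_dense mu D ->
  exists q : nat -> set T, (forall n, D (q n)) /\ mu (~` \bigcup_n q n) = 0.
Proof.
move=> [Delt Ddense].
have [q0 [Dq0 _]] : exists q, D q /\ ma_le mu q setT.
  by apply: Ddense; split=> //; rewrite probability_setT.
have [q /Delt[]//||q [Dq nq]] := @essential_union _ _ _ mu D; first by exists q0.
exists q; split=> //; apply: contrapT => /eqP nq0.
have mq n : measurable (q n) by have [] := Delt _ (Dq n).
have mU : measurable (\bigcup_n q n) by exact: bigcupT_measurable.
have mnU := measurableC mU.
have [p [Dp pU]] := Ddense _ (conj mnU (measure_gt0 mnU nq0)).
have [mp p0] := Delt _ Dp; suff : mu p = 0 by move=> h; move: p0; rewrite h ltxx.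
rewrite (measureDI mu mp mU) [X in X + _](nq _ Dp) add0e.
by move: pU; rewrite /ma_le setDE setCK.
Qed.

Lemma finite_union_almost_full (q : nat -> set T) (e : R) :
  (forall n, measurable (q n)) -> mu (~` \bigcup_n q n) = 0 -> (0 < e)%R ->
  exists k, mu (~` \bigcup_(n < k) q n) <= e%:E.
Proof.
move=> mq q0 e0; apply: contrapT => nk.
have gtk k : e%:E <= mu (~` \bigcup_(n < k) q n).
  by rewrite leNgt; apply/negP => /ltW h; apply: nk; exists k.
have mqk k : measurable (~` \bigcup_(n < k) q n).
  by apply: measurableC; exact: bigcup_measurable.
have cvq : mu (~` \bigcup_(n < k) q n) @[k --> \oo] -->
    mu (\bigcap_k ~` \bigcup_(n < k) q n).
  apply: nonincreasing_cvg_mu => //.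
  - by rewrite ltey_eq fin_num_measure.
  - exact: bigcap_measurable.
  - move=> m n mn; apply/subsetPset; apply: subsetC => t [i /= im qt].
    by exists i => //=; exact: leq_trans mn.
have : e%:E <= mu (\bigcap_k ~` \bigcup_(n < k) q n).
  by apply: (cvge_to_ge cvq); exact: nearW.
rewrite (_ : \bigcap_k _ = ~` \bigcup_n q n).
  by rewrite q0 lee_fin leNgt e0.
apply/seteqP; split=> t h.
  by move=> [n _ qt]; apply: (h n.+1 Logic.I); exists n => /=.
by move=> k _ [n _ qt]; apply: h; exists n.
Qed.

Lemma common_refinement (I : Type) (S : set I) (q : I -> nat -> set T) :
  countable S -> (forall j n, measurable (q j n)) ->
  (forall j, mu (~` \bigcup_n q j n) = 0) ->
  exists A, ma_elt mu A /\ forall j, S j -> exists k, A `<=` \bigcup_(n < k) q j n.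
Proof.
move=> /countable_injP[g ginj] mq q0.
have /choice[E HE] (m : nat) : exists E : set T, [/\ measurable E,
    mu (~` E) <= ((2^-1 : R) / (2 ^ m.+1)%:R)%:E &
    forall j, S j -> g j = m -> exists k, E `<=` \bigcup_(n < k) q j n].
  have e0 : (0 < (2^-1 : R) / (2 ^ m.+1)%:R)%R.
    by rewrite divr_gt0// ?invr_gt0// ltr0n expn_gt0.
  case: (pselect (exists j, S j /\ g j = m)) => [[j [Sj gj]]|nj].
    have [k qk] := finite_union_almost_full (mq j) (q0 j) e0.
    exists (\bigcup_(n < k) q j n); split=> //; first exact: bigcup_measurable.
    move=> j' Sj' gj'; have -> : j' = j by apply: ginj; rewrite ?inE// gj.
    by exists k.
  exists setT; split=> //; first by rewrite setCT measure0 lee_fin ltW.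
  by move=> j Sj gj; exfalso; apply: nj; exists j.
have mE m : measurable (E m) by case: (HE m).
have mnE m : measurable (~` E m) by exact: measurableC.
have mA : measurable (\bigcap_m E m) by exact: bigcap_measurable.
exists (\bigcap_m E m); split; last first.
  move=> j Sj; have [_ _ /(_ j Sj erefl)[k Ek]] := HE (g j).
  by exists k => t /(_ (g j) Logic.I); exact: Ek.
split=> //; apply: measure_gt0 => //; apply/eqP => A0.
have nA : mu (~` \bigcap_m E m) <= (2^-1 : R)%:E.
  rewrite setC_bigcap; apply: le_trans (epsilon_trick0 xpredT _); last by [].
  apply: le_trans (generalized_Boole_inequality mu mnE _) _.
    exact: bigcupT_measurable.
  by apply: lee_nneseries => m _ //; case: (HE m).
have := probability_setC mu mA; rewrite A0 sube0 => nA1.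
by move: nA; rewrite nA1 lee_fin; lra.
Qed.

Lemma ultrafilter_ma_filter (z : set_system T) : UltraFilter z ->
  (forall N, measurable N -> mu N = 0 -> z (~` N)) ->
  ma_filter mu [set p | measurable p /\ z p].
Proof.
move=> Uz zN; split=> [p [mp zp]|].
  split=> //; apply: measure_gt0 => //; apply/eqP => p0.
  have := filter_ex (filterI zp (zN _ mp p0)).
  by rewrite setICr => -[].
split; first by exists setT; split; [exact: measurableT|exact: (@filterT _ z _)].
split=> [p q [mp zp] [mq _] pq|p q [mp zp] [mq zq]].
  split=> //; apply: filterS (filterI zp (zN _ (measurableD mp mq) pq)) => t.
  by move=> [pt nt]; apply: contrapT => qt; apply: nt; split.
exists (p `&` q); split; first by split; [exact: measurableI|exact: filterI].
by split; rewrite /ma_le (_ : _ `\` _ = set0) ?measure0//;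
  apply/seteqP; split=> t // [[]].
Qed.

Lemma ultrafilter_bigcup_ord (z : set_system T) (q : nat -> set T) k :
  UltraFilter z -> z (\bigcup_(n < k) q n) -> exists n, z (q n).
Proof.
move=> Uz; elim: k => [|k IH].
  by rewrite bigcup_mkord big_ord0 => /filter_ex[].
rewrite bigcup_mkord big_ord_recr -bigcup_mkord /= => zU.
have [zq|znq] := in_ultra_setVsetC (q k) Uz; first by exists k.
by apply: IH; apply: filterS (filterI zU znq) => t [[//|]].
Qed.

End DenseFamilies.

Lemma corson_metrizable_MA (R : realType) :
  corson_positive_measure_metrizable R -> MA_omega1_measure_algebras R.
Proof.
move=> met d T mu I D [ncI [lt [wf [tr [tot seg]]]]] Ddense.
apply: contrapT => noG.
have /choice[q Hq] i := dense_countable_cover (Ddense i).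
have mq i n : measurable (q i n).
  by have [Dq _] := Hq i; have [+ _] := Ddense i; move=> /(_ _ (Dq n))[].
have /choice[A HA] i :=
  common_refinement (seg i) mq (fun j => (Hq j).2).
have mA i : measurable (A i) by have [[]] := HA i.
have centered_countable (J : set I) : (forall F, finite_set F -> F `<=` J ->
    (0 < mu (\bigcap_(i in F) A i))%E) -> countable J.
  move=> centJ; apply: contrapT => ncJ; apply: noG.
  have [z [Uz [zA zN]]] := centered_ultrafilter (fun i _ => mA i) centJ.
  exists [set p | measurable p /\ z p]; split; first exact: ultrafilter_ma_filter.
  (* An uncountable [J] has an index [i] past [j]. The member [A i] of [z] lies in a finite union of
     elements of [D j], so one of these elements is in [z]. *)
  move=> j; have [i Ji ji] : exists2 i, J i & lt j i.
    apply: contrapT => nji; apply: ncJ.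
    apply: (@countableS _ _ ([set a | lt a j] `|` [set j])).
      move=> a Ja; case: (tot a j) => [|[|ja]]; [by left|by right|].
      by exfalso; apply: nji; exists a.
    exact/countableU/countable1.
  have [k Ak] := (HA i).2 j ji.
  have [n zq] := ultrafilter_bigcup_ord Uz (filterS Ak (zA i Ji)).
  by exists (q j n); split; [split|exact: (Hq j).1].
(* The contradiction comes from the pattern space of the [A i], which the assumption [met] declares
   metrizable. *)
apply: (@pattern_not_metrizable _ _ _ mu _ A mA centered_countable ncI).
  by move=> i; have [[]] := HA i.
apply: met; first exact: pattern_corson.
exists (@pattern_measure _ _ _ mu _ _ mA); split.
  exact: pattern_measure_radon.
exact: pattern_measure_strictly_positive.
Qed.

Theorem mainTheorem7 (R : realType) :
  corson_positive_measure_metrizable R <-> MA_omega1_measure_algebras R.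
Proof. by split; [exact: corson_metrizable_MA|exact: MA_corson_metrizable]. Qed.
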